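(* Let $m$ be any positive integer and let $A_1,\ldots,A_m$ be matrices that all lie in $\langle\mathbf{RS}_n\rangle$ (resp. all lie in $\langle\mathbf{CS}_n\rangle$). Then $$(A_1\cdots A_m)_{\mathbf{DS}}=(A_1)_{\mathbf{DS}}\cdots(A_m)_{\mathbf{DS}}.$$ In consequence, the following identities hold for every $i\in\{1,\ldots,m\}$: $$\operatorname{spec}(A_1\cdots A_m)=\operatorname{spec}((A_1)_{\mathbf{DS}}\cdots(A_m)_{\mathbf{DS}})=\operatorname{spec}(A_1\cdots A_{i-1}(A_i)_{\mathbf{DS}}A_{i+1}\cdots A_m),$$ $$\operatorname{tr}(A_1\cdots A_m)=\operatorname{tr}((A_1)_{\mathbf{DS}}\cdots(A_m)_{\mathbf{DS}})=\operatorname{tr}(A_1\cdots A_{i-1}(A_i)_{\mathbf{DS}}A_{i+1}\cdots A_m).$$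
   Context: $n$ is a positive integer. $\mathbf{DS}_n$, $\mathbf{RS}_n$, $\mathbf{CS}_n$ are the sets of $n\times n$ doubly stochastic, row stochastic, and column stochastic matrices (real, entrywise nonnegative, with all row and column sums, all row sums, or all column sums, respectively, equal to $1$). $\langle\cdot\rangle$ denotes the real linear span. Let $e=(1,\ldots,1)^t\in\mathbb{R}^n$. For $A=[a_{ij}]\in M_n(\mathbb{R})$ put $s_A=\frac1{n^2}\sum_{i,j}a_{ij}$, $r(A)=(r_1,\ldots,r_n)^t$ with $r_i=\frac1n\sum_ka_{ki}-s_A$, $c(A)=(c_1,\ldots,c_n)^t$ with $c_i=\frac1n\sum_ka_{ik}-s_A$, and $A_R=e\,r(A)^t$, $A_C=c(A)\,e^t$, $A_{\mathbf{DS}}=A-A_R-A_C$ (so $A_{\mathbf{DS}}\in\langle\mathbf{DS}_n\rangle$). $\operatorname{spec}$ is the spectrum (multiset of complex eigenvalues) counting multiplicities. *)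

(* Defs.v *)
From HB Require Import structures.
From mathcomp Require Import all_boot all_order all_algebra.
From mathcomp Require Import finmap multiset complex reals.

Set Implicit Arguments.
Unset Strict Implicit.
Unset Printing Implicit Defensive.

Import Order.TTheory GRing.Theory Num.Theory.
Local Open Scope ring_scope.
Local Open Scope mset_scope.

(* vector.v's <<X>> only spans finite sequences; the sets spanned here are
   infinite, hence the explicit finite linear combinations. *)
Definition linear_span (R : pzRingType) (V : lmodType R) (S : V -> Prop)
    (v : V) : Prop :=
  exists (k : nat) (a : 'I_k -> R) (x : 'I_k -> V),
    (forall i, S (x i)) /\ v = \sum_(i < k) a i *: x i.

Section Stochastic.
Variables (R : realType) (n : nat).
Implicit Types A : 'M[R]_n.

Definition row_stochastic A : Prop :=
  (forall i j, 0 <= A i j) /\ (forall i, \sum_j A i j = 1).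

Definition column_stochastic A : Prop :=
  (forall i j, 0 <= A i j) /\ (forall j, \sum_i A i j = 1).

Definition ones : 'cV[R]_n := const_mx 1.

Definition entry_mean A : R := (n%:R ^+ 2)^-1 * \sum_i \sum_j A i j.

(* Indexed by columns: the mean of the i-th column of A, minus the mean of
   all entries. *)
Definition r_vec A : 'cV[R]_n :=
  \col_i (n%:R^-1 * (\sum_k A k i) - entry_mean A).

(* The same for the i-th row of A. *)
Definition c_vec A : 'cV[R]_n :=
  \col_i (n%:R^-1 * (\sum_k A i k) - entry_mean A).

Definition R_part A : 'M[R]_n := ones *m (r_vec A)^T.

Definition C_part A : 'M[R]_n := c_vec A *m ones^T.

Definition DS_part A : 'M[R]_n := A - R_part A - C_part A.

Definition char_poly_complex A : {poly R[i]} :=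
  char_poly (map_mx (real_complex R) A).

(* Complex eigenvalues with algebraic multiplicity; the witness provided by
   closed_field_poly_normal is a list of the roots of the polynomial, each
   repeated according to its multiplicity. *)
Definition spec A : {mset R[i]} :=
  seq_mset (sval (closed_field_poly_normal (char_poly_complex A))).

Lemma char_poly_spec A :
  char_poly_complex A = \prod_(z <- spec A) ('X - z%:P).
Proof.
rewrite /spec (perm_big _ (perm_eq_seq_mset _)) /=.
case: closed_field_poly_normal => s /= {1}->.
by rewrite (monicP (char_poly_monic _)) scale1r.
Qed.

Lemma specE A z : spec A z = mup z (char_poly_complex A).
Proof. by rewrite char_poly_spec mu_prod_XsubC count_mem_mset. Qed.

Lemma mem_spec A z :
  (z \in spec A) = eigenvalue (map_mx (real_complex R) A) z.
Proof.
by rewrite eigenvalue_root_char -/(char_poly_complex A) char_poly_spec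
  root_prod_XsubC.
Qed.

End Stochastic.

(* Main.v *)
Require Import Defs.
From mathcomp Require Import all_boot all_order all_algebra.
From mathcomp Require Import finmap multiset complex reals.

Set Implicit Arguments.
Unset Strict Implicit.
Unset Printing Implicit Defensive.

Import GRing.Theory.
Local Open Scope ring_scope.

(** Let J be the averaging matrix, all of whose entries are 1/n; it is
    idempotent.  The left factor J replaces each column by its mean, and the
    right factor J does the same for rows, so r(A) and c(A) are encoded by
    JA - JAJ and AJ - JAJ, and the DS part of A turns out to be the pinching
    JAJ + (1 - J)A(1 - J) of A along J ([DS_partE]): it is what remains of A
    after deleting the two off-diagonal blocks for the decomposition of the
    space into the line of constant vectors and the vectors of sum zero.

    If A has constant row sums, it preserves the line of constant vectors,
    which is the image of J; if A has constant column sums, it preserves the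
    vectors of sum zero, which form the image of 1 - J.  The pinching is
    symmetric in J and 1 - J, so in both cases the statement is about an
    idempotent p and the block triangular elements, those with ap = pap.  On
    that subring the diagonal part is multiplicative ([pinch_prod]), and
    passing to the diagonal blocks of a block triangular matrix does not
    change its characteristic polynomial ([char_poly_pinch]).  The product
    with a single pinched factor has the same pinching as the full product,
    so all three products share one characteristic polynomial, hence spectrum
    and trace. *)

(** * Pinching along an idempotent of a ring *)

Section Pinch.
Variable T : pzRingType.
Implicit Types p a b : T.

Definition pinch p a : T := p * a * p + (1 - p) * a * (1 - p).

(** Block triangularity: when T acts on the left, the image of p is invariant
    under a. *)
Definition preserves p a : Prop := a * p = p * a * p.

Lemma pinchC p a : pinch (1 - p) a = pinch p a.
Proof. by rewrite /pinch subKr addrC. Qed.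

Lemma idem_mul_compl p : p * p = p -> p * (1 - p) = 0.
Proof. by move=> pp; rewrite mulrBr mulr1 pp subrr. Qed.

Lemma idem_compl p : p * p = p -> (1 - p) * (1 - p) = 1 - p.
Proof. by move=> pp; rewrite mulrBl mul1r idem_mul_compl // subr0. Qed.

Lemma compl_mul_idem p : p * p = p -> (1 - p) * p = 0.
Proof. by move=> pp; rewrite mulrBl mul1r pp subrr. Qed.

Lemma preserves_corner p a : preserves p a -> (1 - p) * a * p = 0.
Proof. by move=> pa; rewrite -mulrA mulrBl mul1r mulrA -pa subrr. Qed.

Lemma preserves_comm p a : p * p = p -> GRing.comm a p -> preserves p a.
Proof. by move=> pp ap; rewrite /preserves -ap -mulrA pp. Qed.

Lemma preservesB p a b : preserves p a -> preserves p b -> preserves p (a - b).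
Proof. by move=> pa pb; rewrite /preserves mulrBr !mulrBl -pa -pb. Qed.

Lemma preservesM p a b : preserves p a -> preserves p b -> preserves p (a * b).
Proof.
move=> pa pb; rewrite /preserves.
have -> : p * (a * b) * p = p * a * p * b * p.
  by rewrite -mulrA -(mulrA a) pb !mulrA.
by rewrite -pa -mulrA pb !mulrA.
Qed.

Lemma pinch_mulr p a : p * p = p -> pinch p a * p = p * a * p.
Proof.
move=> pp; rewrite /pinch mulrDl -mulrA pp -[(1 - p) * a * (1 - p) * p]mulrA.
by rewrite compl_mul_idem // mulr0 addr0.
Qed.

Lemma compl_mul_pinch p a :
  p * p = p -> (1 - p) * pinch p a = (1 - p) * a * (1 - p).
Proof.
move=> pp; rewrite /pinch mulrDr !mulrA compl_mul_idem // !mul0r add0r.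
by rewrite idem_compl.
Qed.

Lemma preserves_pinch p a : p * p = p -> preserves p (pinch p a).
Proof. by move=> pp; rewrite /preserves -mulrA pinch_mulr // !mulrA pp. Qed.

Lemma pinch_preserved p a : preserves p a -> pinch p a = a * p + (1 - p) * a.
Proof.
move=> pa; rewrite /pinch -pa; congr (_ + _).
by rewrite mulrBr mulr1 preserves_corner // subr0.
Qed.

Lemma pinch_pinch p a : p * p = p -> pinch p (pinch p a) = pinch p a.
Proof.
move=> pp; rewrite (pinch_preserved (preserves_pinch a pp)).
by rewrite pinch_mulr // compl_mul_pinch.
Qed.

(** For block triangular elements the pinching is a p + (1 - p) a.  In a
    product of two such sums, one cross term contains p (1 - p) = 0 and the
    other is the corner (1 - p) (a b) p, zero because a b is again block
    triangular. *)
Lemma pinchM p a b : p * p = p -> preserves p a -> preserves p b ->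
  pinch p (a * b) = pinch p a * pinch p b.
Proof.
move=> pp pa pb; have pab := preservesM pa pb.
rewrite !pinch_preserved // [RHS]mulrDl !mulrDr.
have -> : a * p * (b * p) = a * b * p by rewrite -mulrA (mulrA p) -pb mulrA.
have -> : a * p * ((1 - p) * b) = 0.
  by rewrite mulrA -(mulrA a) idem_mul_compl // mulr0 mul0r.
have -> : (1 - p) * a * (b * p) = 0.
  by rewrite mulrA -(mulrA _ a) preserves_corner.
have -> : (1 - p) * a * ((1 - p) * b) = (1 - p) * (a * b).
  by rewrite mulrA mulrBr mulr1 preserves_corner // subr0 mulrA.
by rewrite addr0 add0r.
Qed.

Lemma preserves_prod p m (a : 'I_m -> T) : p * p = p ->
  (forall j, preserves p (a j)) -> preserves p (\prod_(j < m) a j).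
Proof.
move=> pp pa; apply: (big_ind (preserves p)) => //; last exact: preservesM.
by apply: preserves_comm => //; apply/commr_sym/commr1.
Qed.

Lemma pinch_comm p a : p * p = p -> GRing.comm a p -> pinch p a = a.
Proof.
move=> pp ap; rewrite pinch_preserved ?ap; last exact: preserves_comm.
by rewrite -mulrDl addrC subrK mul1r.
Qed.

Lemma pinchB p a b : pinch p (a - b) = pinch p a - pinch p b.
Proof. by rewrite /pinch !(mulrBr _ a) !(mulrBl _ _ (_ * b)) addrACA opprD. Qed.

Lemma pinch_prod p m (a : 'I_m -> T) : p * p = p ->
  (forall j, preserves p (a j)) ->
  pinch p (\prod_(j < m) a j) = \prod_(j < m) pinch p (a j).
Proof.
move=> pp; elim: m a => [|m IH] a pa; first rewrite !big_ord0.
  by apply: pinch_comm => //; apply/commr_sym/commr1.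
by rewrite !big_ord_recl pinchM // ?IH //; apply: preserves_prod.
Qed.

(** An element and its pinching share the right factor x p + (1 - p), and
    their left factors have the forms 1 + u v and 1 + v u, which are
    indistinguishable to a determinant. *)
Lemma preserves_factor p x : p * p = p -> preserves p x ->
  x = (1 + (x - 1) * (1 - p)) * (x * p + (1 - p)).
Proof.
move=> pp px; have -> : 1 + (x - 1) * (1 - p) = p + x * (1 - p).
  by rewrite mulrBl mul1r addrCA subKr addrC.
have xE : x = x * p + x * (1 - p) by rewrite -mulrDr addrC subrK mulr1.
move: (preserves_corner px) (idem_mul_compl pp) (idem_compl pp) xE.
move: (1 - p) => q qxp pq qq xE.
rewrite mulrDl !mulrDr pq addr0 mulrA -px -(mulrA x q q) qq.
by rewrite -mulrA (mulrA q x p) qxp mulr0 add0r -xE.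
Qed.

Lemma pinch_factor p x : p * p = p -> preserves p x ->
  pinch p x = (1 + (1 - p) * (x - 1)) * (x * p + (1 - p)).
Proof.
move=> pp px; have -> : 1 + (1 - p) * (x - 1) = p + (1 - p) * x.
  by rewrite mulrBr mulr1 addrCA subKr addrC.
rewrite /pinch.
move: (preserves_corner px) (idem_mul_compl pp) => qxp pq.
have qx : (1 - p) * x = (1 - p) * x * (1 - p).
  by rewrite [RHS]mulrBr mulr1 qxp subr0.
move: (1 - p) qxp pq qx => q qxp pq qx.
rewrite [RHS]mulrDl !mulrDr pq addr0 mulrA.
by rewrite {2}qx -(mulrA _ q) (mulrA q x p) qxp mulr0 add0r.
Qed.

End Pinch.

(** * Pinching and the characteristic polynomial *)

(** Both sides are Schur complements of the block matrix with rows (1, X) and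
    (-Y, 1). *)
Lemma det_add1_mulmxC (K : comPzRingType) m n (X : 'M[K]_(m, n))
    (Y : 'M[K]_(n, m)) : \det (1%:M + X *m Y) = \det (1%:M + Y *m X).
Proof.
have eq_prod : block_mx 1%:M 0 Y 1%:M *m
    (block_mx (1%:M + X *m Y) X 0 1%:M *m block_mx 1%:M 0 (- Y) 1%:M) =
  block_mx 1%:M X 0 (1%:M + Y *m X).
  rewrite !mulmx_block !mul1mx !mul0mx !mulmx1 !mulmx0 !add0r !addr0.
  by rewrite mulmxN addrK mulmx1 subrr addrC.
have := congr1 determinant eq_prod.
by rewrite !det_mulmx !det_lblock !det_ublock !det1 !mul1r !mulr1.
Qed.

Lemma det_pinch (K : comPzRingType) n (P M : 'M[K]_n) :
  P * P = P -> preserves P M -> \det (pinch P M) = \det M.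
Proof.
move=> PP PM; rewrite pinch_factor // [in RHS](preserves_factor PP PM).
by rewrite !det_mulmx det_add1_mulmxC.
Qed.

(** The matrix 'X - A is block triangular whenever A is, because scalar
    matrices commute with P; its determinant is that of its pinching. *)
Lemma char_poly_pinch (K : comNzRingType) n (P A : 'M[K]_n) :
  P * P = P -> preserves P A -> char_poly (pinch P A) = char_poly A.
Proof.
move=> PP PA; pose c : {rmorphism 'M[K]_n -> 'M[{poly K}]_n} := map_mx polyC.
have cPP : c P * c P = c P by rewrite -rmorphM PP.
have XcP : GRing.comm ('X%:M : 'M[{poly K}]_n) (c P) by apply/esym/scalar_mxC.
have cPA : preserves (c P) (c A) by rewrite /preserves -!rmorphM -PA.
have cpinch : c (pinch P A) = pinch (c P) (c A).
  by rewrite /pinch rmorphD !rmorphM rmorphB rmorph1.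
have XPc : char_poly_mx (pinch P A) = pinch (c P) ('X%:M - c A).
  by rewrite pinchB (pinch_comm cPP XcP) -cpinch.
rewrite /char_poly XPc det_pinch //.
by apply: preservesB => //; apply: preserves_comm.
Qed.

(** * The doubly stochastic part as a pinching *)

Section DSPart.
Variables (R : realType) (n : nat).
Hypothesis n_gt0 : (0 < n)%N.
Implicit Types A : 'M[R]_n.

Definition mean_mx : 'M[R]_n := const_mx n%:R^-1.

Let n_neq0 : n%:R != 0 :> R.
Proof. by rewrite Num.Theory.pnatr_eq0 -lt0n. Qed.

Lemma mean_mx_idem : mean_mx * mean_mx = mean_mx.
Proof.
apply/matrixP=> i j; rewrite !mxE.
under eq_bigr do rewrite !mxE.
by rewrite sumr_const card_ord -[_ *+ n]mulr_natl mulrA mulfV // mul1r.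
Qed.

Lemma mean_mxM A i j : (mean_mx * A) i j = n%:R^-1 * \sum_k A k j.
Proof. by rewrite !mxE mulr_sumr; apply: eq_bigr => k _; rewrite !mxE. Qed.

Lemma mulmx_mean A i j : (A * mean_mx) i j = n%:R^-1 * \sum_k A i k.
Proof.
by rewrite !mxE mulr_sumr; apply: eq_bigr => k _; rewrite !mxE mulrC.
Qed.

Lemma mean_mx_sandwich A i j : (mean_mx * A * mean_mx) i j = entry_mean A.
Proof.
rewrite mulmx_mean; under eq_bigr do rewrite mean_mxM.
by rewrite -mulr_sumr mulrA -invfM -expr2 exchange_big.
Qed.

Lemma DS_partE A : DS_part A = pinch mean_mx A.
Proof.
have -> : pinch mean_mx A = A - (mean_mx * A - mean_mx * A * mean_mx)
                              - (A * mean_mx - mean_mx * A * mean_mx).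
  rewrite /pinch (mulrBl A) mul1r mulrBr mulr1 (mulrBl mean_mx) addrA.
  by congr (_ - _); rewrite opprB addrCA.
apply/matrixP=> i j.
have DSij : DS_part A i j = A i j - r_vec A j 0 - c_vec A i 0.
  by rewrite !(mxE, big_ord1) mul1r mulr1.
have subE (B C : 'M[R]_n) : (B - C) i j = B i j - C i j by rewrite !mxE.
rewrite DSij !subE mean_mx_sandwich mean_mxM mulmx_mean.
by rewrite [r_vec _ _ _]mxE [c_vec _ _ _]mxE.
Qed.

(** Constant row sums mean that the constant vectors, which span the image of
    the averaging matrix, are eigenvectors. *)
Lemma preserves_row_stochastic A :
  linear_span (@row_stochastic R n) A -> preserves mean_mx A.
Proof.
case=> k [a [x [x_rs ->]]]; rewrite /preserves mulr_sumr !mulr_suml.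
apply: eq_bigr => l _; have [_ xl1] := x_rs l.
have xJ : x l * mean_mx = mean_mx.
  by apply/matrixP=> i j; rewrite mulmx_mean xl1 mulr1 mxE.
have axJ : (a l *: x l) * mean_mx = a l *: mean_mx.
  by rewrite -[in RHS]xJ; apply/esym/scalemxAl.
by rewrite -mulrA axJ -[in LHS]mean_mx_idem; apply: scalemxAr.
Qed.

(** Constant column sums mean that the space of vectors of sum zero, the
    kernel of the averaging matrix, is invariant. *)
Lemma preserves_column_stochastic A :
  linear_span (@column_stochastic R n) A -> preserves (1 - mean_mx) A.
Proof.
move=> A_cs; have JA : mean_mx * A = mean_mx * A * mean_mx.
  case: A_cs => k [a [x [x_cs ->]]]; rewrite mulr_sumr mulr_suml.
  apply: eq_bigr => l _; have [_ xl1] := x_cs l.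
  have Jx : mean_mx * x l = mean_mx.
    by apply/matrixP=> i j; rewrite mean_mxM xl1 mulr1 mxE.
  have Jax : mean_mx * (a l *: x l) = a l *: mean_mx.
    by rewrite -[in RHS]Jx; apply/esym/scalemxAr.
  by rewrite Jax -[in LHS]mean_mx_idem; apply: scalemxAl.
have JAq : mean_mx * (A * (1 - mean_mx)) = 0.
  by rewrite mulrA mulrBr mulr1 -JA subrr.
by rewrite /preserves -mulrA [RHS]mulrBl mul1r JAq subr0.
Qed.

End DSPart.

(** * Spectrum and trace of products *)

Lemma spec_char_poly (R : realType) n (A B : 'M[R]_n) :
  char_poly A = char_poly B -> spec A = spec B.
Proof. by move=> AB; rewrite /spec /char_poly_complex -!map_char_poly AB. Qed.

Lemma mxtrace_char_poly (K : nzRingType) n (A B : 'M[K]_n) :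
  (0 < n)%N -> char_poly A = char_poly B -> \tr A = \tr B.
Proof.
by move=> n_gt0 AB; apply: oppr_inj; rewrite -!char_poly_trace // AB.
Qed.

Theorem theorem2p4 (R : realType) (n : nat) (n_gt0 : (0 < n)%N)
    (m : nat) (m_gt0 : (0 < m)%N) (A : 'I_m -> 'M[R]_n)
    (hA : (forall i, linear_span (@row_stochastic R n) (A i)) \/
          (forall i, linear_span (@column_stochastic R n) (A i))) :
  DS_part (\prod_(j < m) A j) = \prod_(j < m) DS_part (A j) /\
  forall i : 'I_m,
    [/\ spec (\prod_(j < m) A j) = spec (\prod_(j < m) DS_part (A j)),
        spec (\prod_(j < m) DS_part (A j)) =
          spec (\prod_(j < m) (if j == i then DS_part (A j) else A j)),
        \tr (\prod_(j < m) A j) = \tr (\prod_(j < m) DS_part (A j)) &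
        \tr (\prod_(j < m) DS_part (A j)) =
          \tr (\prod_(j < m) (if j == i then DS_part (A j) else A j))].
Proof.
(* P projects onto the constant vectors in the row case and onto the vectors
   of sum zero in the column case. *)
have [P [PP PA DS_P]] : exists P : 'M[R]_n,
    [/\ P * P = P, forall j, preserves P (A j) &
        forall B, DS_part B = pinch P B].
  have JJ := mean_mx_idem R n_gt0.
  case: hA => hA.
    exists (mean_mx R n); split=> // [j | B]; last exact: DS_partE.
    exact: preserves_row_stochastic.
  exists (1 - mean_mx R n); split=> [|j|B]; first exact: idem_compl.
    exact: preserves_column_stochastic.
  by rewrite pinchC DS_partE.
have DS_prod (B : 'I_m -> 'M[R]_n) : (forall j, preserves P (B j)) ->
    DS_part (\prod_(j < m) B j) = \prod_(j < m) DS_part (B j).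
  move=> PB; rewrite DS_P pinch_prod //.
  by apply: eq_bigr => j _; rewrite DS_P.
split=> [|i]; first exact: DS_prod.
pose B j := if j == i then DS_part (A j) else A j.
have PB j : preserves P (B j).
  by rewrite /B; case: eqP => // _; rewrite DS_P; apply: preserves_pinch.
(* Pinching one factor is invisible after pinching all of them. *)
have DS_B j : DS_part (B j) = DS_part (A j).
  by rewrite /B; case: eqP => // _; rewrite !DS_P pinch_pinch.
have char_prod (C : 'I_m -> 'M[R]_n) : (forall j, preserves P (C j)) ->
    char_poly (\prod_(j < m) DS_part (C j)) = char_poly (\prod_(j < m) C j).
  move=> PC; rewrite -DS_prod // DS_P char_poly_pinch //.
  exact: preserves_prod.
have eqA := char_prod A PA.
have eqB : char_poly (\prod_(j < m) DS_part (A j)) =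
    char_poly (\prod_(j < m) B j).
  by rewrite -(char_prod B) // (eq_bigr _ (fun j _ => DS_B j)).
split.
- exact/esym/spec_char_poly.
- exact: spec_char_poly.
- exact/esym/mxtrace_char_poly.
- exact: mxtrace_char_poly.
Qed.
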